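(* Let $n\ge1$, let $A=(A_1,\dots,A_n)\in\mathbb{R}^n$ be a nonnegative vector, and let $D=n+A_1+\cdots+A_n$. (1) For any $f\in L^2(\mathbb{R}^n,x^A\,dx)$ with $\int_{\mathbb{R}^n_A}|f|^2x^A\,dx=1$ and $\int_{\mathbb{R}^n_A}|f|^2|x|^2x^A\,dx<\infty$, $$-\int_{\mathbb{R}^n_A}|f|^2\log|f|^2\,x^A\,dx\le\frac D2\log\left(\frac{2\,\Pi(A)\,e}{D}\int_{\mathbb{R}^n_A}|f|^2|x|^2x^A\,dx\right).$$ (2) More generally, for any $\alpha>0$ and any $f\in L^1_\alpha(\mathbb{R}^n,x^A\,dx)$ with $\int_{\mathbb{R}^n_A}|f|\,x^A\,dx=1$, $$-\int_{\mathbb{R}^n_A}|f|\log|f|\,x^A\,dx\le\frac D\alpha\log\left(\frac{\alpha\,C_A(\alpha)\,e}{D}\int_{\mathbb{R}^n_A}|f|\,|x|^\alpha x^A\,dx\right),$$ where $$C_A(\alpha)=\left(\frac{\Gamma\left(\frac D\alpha+1\right)}{\Gamma\left(\frac D2+1\right)}\,\Pi(A)^{\frac D2}\right)^{\alpha/D}.$$ Equality in (2) holds if $f(x)=\exp(-C_A(\alpha)|x|^\alpha)$, up to scaling (i.e. also for $\lambda^Df(\lambda x)$, $\lambda>0$).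
   Context: Notation: $\mathbb{R}^n_A=\{x\in\mathbb{R}^n: x_i>0\text{ if }A_i>0\}$; $x^A=|x_1|^{A_1}\cdots|x_n|^{A_n}$; $\Gamma$ is the Gamma function; $\Pi(A)=\left[2^{-k}\prod_{i=1}^n\Gamma\left(\frac{A_i+1}{2}\right)\right]^{2/D}$ with $k=\sharp\{i:A_i>0\}$. For $\alpha>0$, $L^1_\alpha(\mathbb{R}^n,x^A\,dx)=\{f\in L^1(\mathbb{R}^n,x^A\,dx):\int_{\mathbb{R}^n_A}|f|\,|x|^\alpha x^A\,dx<\infty\}$. Convention: $0\log0=0$, and the left-hand integrals are understood in the extended sense. *)

(* Defs.v *)
From HB Require Import structures.
From mathcomp Require Import all_boot all_order all_algebra.
From mathcomp Require Import all_classical all_reals all_analysis.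
From mathcomp Require Import measurable_realfun.

Set Implicit Arguments.
Unset Strict Implicit.
Unset Printing Implicit Defensive.

Import Order.TTheory GRing.Theory Num.Theory.
Import numFieldNormedType.Exports.

Local Open Scope classical_set_scope.
Local Open Scope ring_scope.

(* Lebesgue measure on R^n (Borel sets of n.-tuple R), by induction on n:
   the measure in dimension n.+1 is the image of the product of the Lebesgue
   measure of R and of the measure in dimension n under (t, x) |-> t :: x.
   The first factor is measurableTypeR R because lebesgue_measure lives there;
   its measurable sets are those of R. *)

Definition tcons (R : realType) (n : nat) (p : measurableTypeR R * n.-tuple R) :
  n.+1.-tuple R := [the n.+1.-tuple R of p.1 :: p.2].

Lemma measurable_tcons (R : realType) (n : nat) :
  measurable_fun [set: measurableTypeR R * n.-tuple R] (@tcons R n).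
Proof.
apply: (@measurable_cons _ _ (measurableTypeR R * n.-tuple R)%type R).
  exact: (@measurable_fst _ _ (measurableTypeR R) (n.-tuple R)).
exact: (@measurable_snd _ _ (measurableTypeR R) (n.-tuple R)).
Qed.

Section lebesgue_step.
Context (R : realType) (n : nat).
Variable mu : {sigma_finite_measure set (n.-tuple R) -> \bar R}.

Definition lebesgue_step : set (n.+1.-tuple R) -> \bar R :=
  pushforward (lebesgue_measure \x mu)%E (@tcons R n).

Let lebesgue_step0 : lebesgue_step set0 = 0%E.
Proof. by rewrite /lebesgue_step /pushforward preimage_set0 measure0. Qed.

Let lebesgue_step_ge0 B : (0 <= lebesgue_step B)%E.
Proof. by rewrite /lebesgue_step /pushforward measure_ge0. Qed.

Let lebesgue_step_sigma_additive : semi_sigma_additive lebesgue_step.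
Proof.
move=> F mF tF mUF; rewrite /lebesgue_step /pushforward preimage_bigcup.
have mpre B : measurable B -> measurable (@tcons R n @^-1` B).
  by move=> mB; rewrite -[X in measurable X]setTI; exact: measurable_tcons.
apply: measure_semi_sigma_additive.
- by move=> i; exact: mpre.
- apply/trivIsetP => /= i j _ _ ij; rewrite -preimage_setI.
  by move/trivIsetP : tF => /(_ _ _ _ _ ij) ->//; rewrite preimage_set0.
- by rewrite -preimage_bigcup; exact: mpre.
Qed.

HB.instance Definition _ := isMeasure.Build _ _ _ lebesgue_step
  lebesgue_step0 lebesgue_step_ge0 lebesgue_step_sigma_additive.

Let lebesgue_step_sigma_finite : sigma_finite setT lebesgue_step.
Proof.
have /sigma_finiteP[F [TF ndF Foo]] := sigma_finiteT (@lebesgue_measure R).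
have /sigma_finiteP[G [TG ndG Goo]] := sigma_finiteT mu.
pose H k : set (n.+1.-tuple R) :=
  [set x | F k (thead x) /\ G k [tuple of behead x]].
exists H.
  apply/seteqP; split=> // x _.
  have [i _ Fi] : (\bigcup_i F i) (thead x) by rewrite -TF.
  have [j _ Gj] : (\bigcup_i G i) [tuple of behead x] by rewrite -TG.
  exists (maxn i j) => //; split.
    by move: Fi; exact/subsetPset/ndF/leq_maxl.
  by move: Gj; exact/subsetPset/ndG/leq_maxr.
move=> k; have [mF Fk] := Foo k; have [mG Gk] := Goo k; split.
  rewrite (_ : H k = (@thead n R) @^-1` (F k) `&`
    (fun x : n.+1.-tuple R => [tuple of behead x]) @^-1` (G k))//.
  apply: measurableI.
    by rewrite -[X in measurable X]setTI; exact: measurable_tnth.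
  by rewrite -[X in measurable X]setTI; exact: measurable_behead.
rewrite /lebesgue_step /pushforward (_ : _ @^-1` _ = F k `*` G k); last first.
  have tconsK (t : R) (x : n.-tuple R) : [tuple of behead (tcons (t, x))] = x.
    exact/val_inj.
  by apply/seteqP; split=> -[t x]; rewrite /H /preimage /= tconsK theadE.
by rewrite product_measure1E// lte_mul_pinfty// ge0_fin_numE.
Qed.

HB.instance Definition _ := @Measure_isSigmaFinite.Build _ _ _ lebesgue_step
  lebesgue_step_sigma_finite.

End lebesgue_step.

Fixpoint lebesgueRn (R : realType) (n : nat) :
    {sigma_finite_measure set (n.-tuple R) -> \bar R} :=
  match n with
  | 0%N => (@dirac _ (0.-tuple R) [tuple] R : {sigma_finite_measure set _ -> \bar R})
  | m.+1 => (lebesgue_step (lebesgueRn R m) : {sigma_finite_measure set _ -> \bar R})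
  end.

Section monomial_weight.
Context (R : realType) (n : nat).
Implicit Types A x : n.-tuple R.

Definition orthantA A : set (n.-tuple R) :=
  [set x | forall i, 0 < tnth A i -> 0 < tnth x i].

(* The factor at i is 1 when tnth A i = 0, even if tnth x i = 0: 0 `^ 0 = 1. *)
Definition monomialA A x : R := \prod_(i < n) `|tnth x i| `^ tnth A i.

Lemma monomialA_ge0 A x : 0 <= monomialA A x.
Proof. by apply: prodr_ge0 => i _; exact: powR_ge0. Qed.

Lemma measurable_monomialA A : measurable_fun [set: n.-tuple R] (monomialA A).
Proof.
apply: measurable_prod => i _.
apply: (@measurableT_comp _ _ _ _ _ _ (fun t : R => `|t| `^ tnth A i)).
  apply: (@measurableT_comp _ _ _ _ _ _ (@powR R ^~ (tnth A i))).
    exact: measurable_powR.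
  exact: normr_measurable.
exact: measurable_tnth.
Qed.

(* The measure x^A dx on all of R^n, not only on orthantA A. *)
Definition measureA A (B : set (n.-tuple R)) : \bar R :=
  (\int[lebesgueRn R n]_(x in B) (monomialA A x)%:E)%E.

Section measureA_is_measure.
Variable A : n.-tuple R.

Let measureA0 : measureA A set0 = 0%E.
Proof. by rewrite /measureA integral_set0. Qed.

Let measureA_ge0 B : (0 <= measureA A B)%E.
Proof. by apply: integral_ge0 => x _; rewrite lee_fin monomialA_ge0. Qed.

Let measureA_sigma_additive : semi_sigma_additive (measureA A).
Proof.
move=> F mF tF mUF; rewrite /measureA; apply: cvg_toP.
  apply: ereal_nondecreasing_is_cvgn => m k mk.
  by apply: lee_sum_nneg_natr => // i _ _; exact: measureA_ge0.
rewrite ge0_integral_bigcup//=.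
- apply/measurable_funTS/measurableT_comp => //.
  exact: measurable_monomialA.
- by move=> x _; rewrite lee_fin monomialA_ge0.
Qed.

HB.instance Definition _ := isMeasure.Build _ _ _ (measureA A)
  measureA0 measureA_ge0 measureA_sigma_additive.

End measureA_is_measure.

Definition dimA A : R := n%:R + \sum_(i < n) tnth A i.

Definition norm2 x : R := Num.sqrt (\sum_(i < n) tnth x i ^+ 2).

(* Euler's integral; only meaningful for 0 < s, where it converges. *)
Definition Gamma (s : R) : R :=
  \int[lebesgue_measure]_(t in `]0, +oo[) (t `^ (s - 1) * expR (- t)).

Definition PiA A : R :=
  ((2 ^+ #|[pred i : 'I_n | 0 < tnth A i]|)^-1 *
    \prod_(i < n) Gamma ((tnth A i + 1) / 2)) `^ (2 / dimA A).

Definition CA A (alpha : R) : R :=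
  (Gamma (dimA A / alpha + 1) / Gamma (dimA A / 2 + 1) *
    PiA A `^ (dimA A / 2)) `^ (alpha / dimA A).

Definition L1alpha A (alpha : R) (f : n.-tuple R -> R) : Prop :=
  f \in Lfun (measureA A) 1%E /\
  (\int[measureA A]_(x in orthantA A) (`|f x| * norm2 x `^ alpha)%:E < +oo)%E.

Definition dilate (lambda : R) x : n.-tuple R := [tuple lambda * tnth x i | i < n].

End monomial_weight.

(* Main.v *)
Require Import Defs.
From HB Require Import structures.
From mathcomp Require Import all_boot all_order all_algebra.
From mathcomp Require Import all_classical all_reals all_analysis.
From mathcomp Require Import measurable_realfun ring lra.

Set Implicit Arguments.
Unset Strict Implicit.
Unset Printing Implicit Defensive.

Import Order.TTheory GRing.Theory Num.Theory.
Import numFieldNormedType.Exports.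

(** The entropy bound is Gibbs' inequality against a one-parameter family of
    radial probability densities. Write nu for the measure x^A dx on the
    orthant and C for CA A alpha. For every b > 0 the function
    (b / C)^(D / alpha) * exp (- b |x|^alpha) has nu-mass 1, so Gibbs'
    inequality (gibbs_inequality) gives, with M the alpha-moment of f,
      - int f ln f  <=  b M + (D / alpha) ln (C / b),
    which is entropy_le_linear. The choice b = D / (alpha M) minimizes the
    right-hand side and produces the stated logarithm (entropy_le). Part (1) is
    the case alpha = 2 applied to |f|^2, because CA A 2 = PiA A. The extremal
    functions are the members of the family themselves; their entropy is
    computed from their mass and their alpha-moment.

    What remains is that mass and that moment. Polar coordinates are replaced
    by two facts. First, nu is homogeneous: the weighted volume of the ball of
    radius r is r^D times that of the unit ball (ball_weight_homogeneous), by
    the scaling of Lebesgue measure. Secondly, a radial function that is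
    written as a tail integral, H(u) = int_(t > u) g(t) dt, can be integrated
    by Tonelli's theorem against the volumes of balls (layer_cake). Together
    they turn any such radial integral into the volume of the unit ball times
    int_(t > 0) t^(D / alpha) g(t) dt, up to a scaling factor
    (layer_cake_radial). With g(t) = exp (- t), where H(u) = exp (- u), this is
    Gamma (D / alpha + 1); with g(t) = t exp (- t), where
    H(u) = (u + 1) exp (- u), it is Gamma (D / alpha + 2), which yields the
    moment. The volume of the unit ball is found by comparing the case
    alpha = 2 with the Gaussian integral, which factors into one-dimensional
    integrals (ball_weight1E, integral_gaussian_orthant). The same layer-cake
    formula on the half-line gives the functional equation of Gamma and the
    one-dimensional Gaussian moments (integral_powR_expR). *)

Local Open Scope classical_set_scope.
Local Open Scope ring_scope.

(** * The layer-cake formula *)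

Lemma integral_mul_indic d (T : measurableType d) (R : realType)
    (mu : {measure set T -> \bar R}) (S : set T) (f : T -> R) :
  (\int[mu]_(x in S) (f x)%:E = \int[mu]_x (f x * \1_S x)%:E)%E.
Proof.
rewrite integral_mkcond; apply: eq_integral => x _.
by rewrite patchE indicE; case: ifP; rewrite ?mulr1 ?mulr0.
Qed.

Lemma measurable_set_ltr d (T : measurableType d) (R : realType)
    (f g : T -> R) : measurable_fun setT f -> measurable_fun setT g ->
  measurable [set x | f x < g x].
Proof.
move=> mf mg; rewrite -[X in measurable X]setTI.
exact: (measurable_fun_ltr mf mg measurableT (Y := [set true])).
Qed.

(** Both sides integrate w x * g t over the pairs with u x < t; since u is
    nonnegative only t > 0 contributes. *)
Lemma layer_cake d (T : measurableType d) (R : realType)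
    (mu : {sigma_finite_measure set T -> \bar R}) (w u : T -> R) (g : R -> R) :
  measurable_fun setT w -> measurable_fun setT u -> measurable_fun setT g ->
  (forall x, 0 <= w x) -> (forall x, 0 <= u x) -> (forall t, 0 < t -> 0 <= g t) ->
  (\int[mu]_x ((w x)%:E * \int[lebesgue_measure]_(t in `]u x, +oo[) (g t)%:E) =
   \int[lebesgue_measure]_(t in `]0%R, +oo[)
     ((g t)%:E * \int[mu]_(x in [set x | (u x < t)%R]) (w x)%:E))%E.
Proof.
move=> mw mu_ mg w0 u0 g0.
pose f (z : T * measurableTypeR R) : \bar R :=
  (w z.1 * g z.2 * \1_[set z | (u z.1 < z.2)%R] z)%:E.
have f0 z : (0 <= f z)%E.
  rewrite lee_fin; have [uz|zu] := ltP (u z.1) z.2.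
    by rewrite mulr_ge0// mulr_ge0// g0// (le_lt_trans (u0 z.1)).
  by rewrite indicE memNset ?mulr0//=; apply/negP; rewrite -leNgt.
have mset : measurable [set z : T * measurableTypeR R | (u z.1 < z.2)%R].
  apply: measurable_set_ltr.
    exact: (measurableT_comp mu_ (@measurable_fst _ _ T (measurableTypeR R))).
  exact: measurable_snd.
have mf : measurable_fun setT f.
  apply/measurable_EFinP; apply: measurable_funM.
    apply: measurable_funM.
      exact: (measurableT_comp mw (@measurable_fst _ _ T (measurableTypeR R))).
    exact: (measurableT_comp mg (@measurable_snd _ _ T (measurableTypeR R))).
  exact: measurable_indic.
transitivity (\int[mu]_x \int[lebesgue_measure]_t f (x, t))%E.
  apply: eq_integral => x _; rewrite -ge0_integralZl//; first last.
  - by rewrite lee_fin.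
  - by move=> t; rewrite /= in_itv/= andbT lee_fin => /(le_lt_trans (u0 x))/g0.
  - by apply/measurable_EFinP; exact: measurable_funTS.
  under [LHS]eq_integral do rewrite -EFinM.
  rewrite integral_mul_indic; apply: eq_integral => t _.
  by rewrite /f /= !indicE !mem_setE/= in_itv/= andbT.
transitivity (\int[lebesgue_measure]_t \int[mu]_x f (x, t))%E.
  exact: fubini_tonelli.
apply/esym; rewrite integral_mkcond; apply: eq_integral => t _.
rewrite patchE mem_setE in_itv/= andbT; case: ifPn => [t0|].
  rewrite -ge0_integralZl//; first last.
  - by rewrite lee_fin g0.
  - by move=> x _; rewrite lee_fin.
  - by apply/measurable_EFinP; exact: measurable_funTS.
  - exact: measurable_set_ltr.
  under [LHS]eq_integral do rewrite -EFinM.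
  rewrite integral_mul_indic; apply: eq_integral => x _.
  by rewrite /f /= !indicE !mem_setE/= (mulrC (g t)).
rewrite -leNgt => t0; apply/esym/integral0_eq => x _; rewrite /f indicE memNset ?mulr0//=.
by apply/negP; rewrite -leNgt (le_trans t0).
Qed.

Section one_dimension.
Context {R : realType}.
Local Notation leb := (@lebesgue_measure R).

(** The primitive t^s / s is differentiable only away from 0 when s < 1, so the
    fundamental theorem is applied on [r / (n + 2), r] and n is sent to
    infinity. *)
Lemma integral_powR (s r : R) : 0 < s -> 0 < r ->
  (\int[leb]_(t in `]0%R, r[) (t `^ (s - 1))%:E = (r `^ s / s)%:E)%E.
Proof.
move=> s0 r0.
pose F (n : nat) := `[r / n.+2%:R, r[%classic.
have e0 n : 0 < r / n.+2%:R :> R by rewrite divr_gt0.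
have er n : r / n.+2%:R < r :> R.
  by rewrite ltr_pdivrMr// ltr_pMr// ltr1n.
have mf : measurable_fun setT (fun t : R => (t `^ (s - 1))%:E).
  by apply/measurable_EFinP; exact: measurable_powR.
have bigF : `]0%R, r[%classic = \bigcup_n F n.
  apply/seteqP; split=> t/=.
    rewrite in_itv/= => /andP[t0 tr]; exists (Num.truncn (r / t)) => //=.
    rewrite /F/= in_itv/= tr andbT ler_pdivrMr// mulrC -ler_pdivrMr//.
    by rewrite (le_trans (ltW (truncnS_gt _)))// ler_nat.
  case=> n _; rewrite /F/= !in_itv/= => /andP[+ ->]; rewrite andbT.
  exact: lt_le_trans.
have FE n : (\int[leb]_(t in F n) (t `^ (s - 1))%:E =
    (r `^ s / s)%:E - ((r / n.+2%:R) `^ s / s)%:E)%E.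
  rewrite integral_itv_bndo_bndc; last exact: measurable_funTS.
  apply: (@continuous_FTC2 _ _ (fun t => t `^ s / s)) => //.
  - apply: derivable_within_continuous => x; rewrite in_itv/= => /andP[xe _].
    by apply: derivable_powR; rewrite in_itv/= andbT (lt_le_trans (e0 n)).
  - have dF x : 0 < x -> derivable (fun t : R => t `^ s / s) x 1.
      move=> x0; apply: derivableM => //.
      by apply: derivable_powR; rewrite in_itv/= andbT.
    have cF x : 0 < x -> {for x, continuous (fun t : R => t `^ s / s)}.
      by move=> x0; apply/differentiable_continuous/derivable1_diffP/dF.
    split.
    + by move=> x; rewrite in_itv/= => /andP[xe _]; apply/dF/(lt_trans _ xe).
    + by apply/cvg_at_right_filter/cF.
    + by apply/cvg_at_left_filter/cF.
  - move=> x; rewrite in_itv/= => /andP[xe _].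
    have x0 : 0 < x by apply: lt_trans xe.
    rewrite (_ : (fun t : R => t `^ s / s) = s^-1 *: (@powR R ^~ s)); last first.
      by apply/funext => t; rewrite mulrC.
    rewrite derive1E deriveZ; last by apply: derivable_powR; rewrite in_itv/= andbT.
    rewrite -derive1E powR_derive1; last by rewrite in_itv/= andbT.
    by rewrite /GRing.scale/= mulKf// gt_eqF.
have ndF : nondecreasing_seq F.
  move=> m n mn; apply/subsetPset => t; rewrite /F/= !in_itv/= => /andP[+ ->].
  rewrite andbT; apply: le_trans.
  by rewrite ler_pM2l// lef_pV2 ?posrE// ler_nat.
(* The intervals [r / (n + 2), r[ increase to ]0, r[. *)
have cvgF : (\int[leb]_(t in F n) (t `^ (s - 1))%:E @[n --> \oo] -->
    \int[leb]_(t in `]0%R, r[) (t `^ (s - 1))%:E)%E.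
  rewrite bigF; apply: (@ge0_nondecreasing_set_cvg_integral _ (measurableTypeR R)) => //.
  - by move=> n; exact: measurable_itv.
  - by move=> n; exact: measurable_funTS.
  - by move=> *; rewrite lee_fin powR_ge0.
apply: (cvg_unique _ cvgF) => //.
rewrite (_ : (fun n => _) = (fun n => (r `^ s / s - (r / n.+2%:R) `^ s / s)%:E)); last first.
  by apply/funext => n; rewrite FE.
apply/fine_cvgP; split; first exact: nearW.
rewrite -[X in _ --> X]subr0; apply: cvgB; first exact: cvg_cst.
rewrite -(mul0r s^-1); apply: cvgMl.
have /cvg_at_rightP cvg0 := @powR_cvg0 R s s0.
apply: (cvg0 (fun n => r / n.+2%:R)); split => //.
rewrite -(mulr0 r); apply: cvgMr.
by have := @cvg_harmonic R; rewrite -cvg_shiftS.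
Qed.

End one_dimension.

(** * Exponential tails and the Gamma function *)

Section exponential_tails.
Context {R : realType}.
Local Notation leb := (@lebesgue_measure R).

Lemma integral_tail (f F : R -> R) (u : R) : (forall x, u <= x -> 0 <= f x) ->
  continuous f -> (forall x : R, is_derive x 1 F (f x)) ->
  F x @[x --> +oo] --> 0 ->
  (\int[leb]_(t in `]u, +oo[) (f t)%:E = (- F u)%:E)%E.
Proof.
move=> f0 cf dF Foo.
rewrite integral_itv_obnd_cbnd; last first.
  by apply/measurable_EFinP/measurable_funTS; exact: continuous_measurable_fun.
rewrite (@ge0_continuous_FTC2y _ f F u 0)//.
- by rewrite sub0e.
- exact: continuous_subspaceT.
- apply: cvg_at_right_filter; apply: differentiable_continuous.
  exact/derivable1_diffP.
- by move=> x _; rewrite derive1E derive_val.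
Qed.

Lemma integral_tail_expR (u : R) :
  (\int[leb]_(t in `]u, +oo[) (expR (- t))%:E = (expR (- u))%:E)%E.
Proof.
have -> : expR (- u) = - (- expR (- u)) by rewrite opprK.
apply: (@integral_tail (fun t => expR (- t)) (fun t => - expR (- t))) => //.
- move=> x; apply: (@continuous_comp _ _ _ -%R expR); last exact: continuous_expR.
  exact: opp_continuous.
- by move=> x; apply: is_derive_eq; rewrite /GRing.scale/= mulrN1 opprK.
- by rewrite -oppr0; apply: cvgN; exact: cvgr_expR.
Qed.

(** The tail that makes the moment accessible: combined with
    integral_tail_expR it expresses u exp (- u) through nonnegative tails. *)
Lemma integral_tail_id_expR (u : R) : 0 <= u ->
  (\int[leb]_(t in `]u, +oo[) (t * expR (- t))%:E = ((u + 1) * expR (- u))%:E)%E.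
Proof.
move=> u0; rewrite -[X in _ = X%:E]opprK.
apply: (@integral_tail (fun t => t * expR (- t))
  (fun t => - ((t + 1) * expR (- t)))) => //.
- by move=> x ux; rewrite mulr_ge0// (le_trans u0).
- move=> x; apply: cvgM => //.
  apply: (@continuous_comp _ _ _ -%R expR); last exact: continuous_expR.
  exact: opp_continuous.
- by move=> x; apply: is_derive_eq; rewrite /GRing.scale/=; ring.
- rewrite -oppr0; apply: cvgN.
  (* t + 1 <= 2 exp (t / 2) *)
  apply: (@squeeze_cvgr _ _ _ _ (fun=> 0) (fun t => 2 * expR (- (t / 2)))).
  + near=> t.
    have t0 : 0 <= t by near: t; apply: nbhs_pinfty_ge.
    rewrite mulr_ge0 ?addr_ge0//= (_ : - t = - (t / 2) + - (t / 2)); last by field.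
    rewrite expRD mulrA ler_wpM2r//.
    rewrite expRN ler_pdivrMr ?expR_gt0//.
    have := expR_ge1Dx (t / 2); lra.
  + exact: cvg_cst.
  + rewrite -(mulr0 2); apply: cvgMr.
    apply: (@cvg_comp _ _ _ (fun t : R => t / 2) (fun t => expR (- t)) _ +oo);
      last exact: cvgr_expR.
    apply/cvgryPge => M; near=> t.
    by rewrite ler_pdivlMr//; near: t; apply: nbhs_pinfty_ge.
Unshelve. all: by end_near. Qed.

End exponential_tails.

Section Gamma_function.
Context {R : realType}.
Local Notation leb := (@lebesgue_measure R).

(** Euler's integral with values in the extended reals: it can be manipulated
    by Tonelli's theorem before it is known to converge. *)
Definition eGamma (s : R) : \bar R :=
  (\int[leb]_(t in `]0%R, +oo[) (t `^ (s - 1) * expR (- t))%:E)%E.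

Lemma measurable_expRN : measurable_fun setT (fun t : R => expR (- t)).
Proof. exact: measurableT_comp. Qed.

Lemma measurable_powR_expRN (p : R) : measurable_fun setT (fun t : R => t `^ p * expR (- t)).
Proof.
apply: measurable_funM; first exact: measurable_powR.
exact: measurable_expRN.
Qed.

(** Layer cake on the half-line for the weight x^(s - 1) and the function
    x^p: the region x^p < t is an interval, of weight t^(s / p) / s. The case
    p = 1 is the functional equation of Gamma, the case p = 2 evaluates the
    Gaussian moments. *)
Lemma integral_powR_expR (p s : R) : 0 < p -> 0 < s ->
  (\int[leb]_(t in `]0%R, +oo[) (t `^ (s - 1) * expR (- (t `^ p)))%:E =
   (s^-1)%:E * eGamma (s / p + 1))%E.
Proof.
move=> p0 s0.
have mw : measurable_fun setT (fun t : R => t `^ (s - 1) * \1_(`]0%R, +oo[) t).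
  by apply: measurable_funM; [exact: measurable_powR|exact: measurable_indic].
have mu_ : measurable_fun setT (fun t : R => `|t| `^ p).
  by apply: (@measurableT_comp _ _ _ _ _ _ (@powR R ^~ p)) => //; exact: measurable_powR.
transitivity (\int[leb]_x ((x `^ (s - 1) * \1_(`]0%R, +oo[) x)%:E *
    \int[leb]_(t in `](`|x| `^ p)%R, +oo[) (expR (- t))%:E))%E.
  rewrite integral_mul_indic; apply: eq_integral => x _.
  rewrite integral_tail_expR -EFinM indicE mem_setE in_itv/= andbT.
  by case: ltP => x0; rewrite ?mulr0 ?mul0r// !mulr1 ger0_norm// ltW.
rewrite (@layer_cake _ _ R leb _ _ _ mw mu_ measurable_expRN); first last.
- by move=> t _; exact: expR_ge0.
- by move=> x; exact: powR_ge0.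
- by move=> x; rewrite mulr_ge0// powR_ge0.
transitivity (\int[leb]_(t in `]0%R, +oo[)
    ((s^-1)%:E * (t `^ (s / p + 1 - 1) * expR (- t))%:E))%E; last first.
  apply: ge0_integralZl => //.
  - by apply/measurable_EFinP/measurable_funTS; exact: measurable_powR_expRN.
  - by move=> t _; rewrite lee_fin mulr_ge0// powR_ge0.
  - by rewrite lee_fin invr_ge0 ltW.
apply: eq_integral => t; rewrite inE/= in_itv/= andbT => t0.
rewrite (_ : (\int[leb]_(x in _) _ = (t `^ (s / p) / s)%:E)%E).
  by rewrite -!EFinM addrK; congr EFin; ring.
rewrite integral_mkcond/=.
have tp0 : 0 < t `^ p^-1 by rewrite powR_gt0.
rewrite [s / p]mulrC powRrM -(integral_powR s0 tp0) [RHS]integral_mkcond.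
apply: eq_integral => x _; rewrite !patchE indicE.
have -> : (x \in [set x : R | `|x| `^ p < t]) = (`|x| `^ p < t).
  by apply/idP/idP => [/set_mem//|h]; exact/mem_set.
rewrite !mem_setE/= !in_itv/= andbT.
case: (ltP 0 x) => x0 /=; last by rewrite mulr0; case: ifP.
have -> : (`|x| `^ p < t) = (x < t `^ p^-1).
  rewrite gtr0_norm//; apply/idP/idP => h.
    have := gt0_ltr_powR (r := p^-1); rewrite invr_gt0 => /(_ p0).
    move=> /(_ (x `^ p) t); rewrite !nnegrE powR_ge0 (ltW t0) => /(_ isT isT h).
    by rewrite -powRrM divff ?gt_eqF// powRr1// ltW.
  have := gt0_ltr_powR p0.
  move=> /(_ x (t `^ p^-1)); rewrite !nnegrE powR_ge0 (ltW x0) => /(_ isT isT h).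
  by rewrite -powRrM mulVf ?gt_eqF// powRr1// ltW.
by rewrite mulr1.
Qed.

Lemma eGammaS (s : R) : 0 < s -> eGamma s = ((s^-1)%:E * eGamma (s + 1))%E.
Proof.
move=> s0; have := integral_powR_expR ltr01 s0; rewrite divr1 => <-.
apply: eq_integral => t; rewrite inE/= in_itv/= andbT => t0.
by rewrite powRr1// ltW.
Qed.

Lemma eGamma_ge0 (s : R) : (0 <= eGamma s)%E.
Proof. by apply: integral_ge0 => t _; rewrite lee_fin mulr_ge0// powR_ge0. Qed.

(** From t / (2 s) <= exp (t / (2 s)) follows t^s <= (2 s)^s exp (t / 2), so
    the integrand is dominated by a multiple of exp (- t / 2). *)
Lemma eGammaS_lty (s : R) : 0 < s -> (eGamma (s + 1) < +oo)%E.
Proof.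
move=> s0; have K0 : 0 <= (2 * s) `^ s by exact: powR_ge0.
have i2 : (\int[leb]_(t in `]0%R, +oo[) (2^-1 * expR (- (t / 2)))%:E = 1%:E)%E.
  have e1 : 1 = - (- expR (- (0 / 2))) :> R by rewrite mul0r oppr0 expR0 opprK.
  rewrite [in RHS]e1.
  apply: (@integral_tail R (fun t => 2^-1 * expR (- (t / 2))) (fun t => - expR (- (t / 2)))).
  - by move=> x _; rewrite mulr_ge0.
  - move=> x; apply: cvgMr; apply: (@continuous_comp _ _ _ (fun t : R => - (t / 2)) expR).
      by apply: cvgN; apply: cvgMl.
    exact: continuous_expR.
  - move=> x; apply: is_derive_eq; rewrite /GRing.scale/=; ring.
  - rewrite -oppr0; apply: cvgN.
    apply: (@cvg_comp _ _ _ (fun t : R => t / 2) (fun t => expR (- t)) _ +oo);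
      last exact: cvgr_expR.
    apply/cvgryPge => M; near=> t.
    by rewrite ler_pdivlMr//; near: t; apply: nbhs_pinfty_ge.
apply: (@le_lt_trans _ _ (((2 * s) `^ s * 2)%:E * 1%:E)%E); last first.
  by rewrite mule1 ltry.
have mh : measurable_fun setT (fun t : R => 2^-1 * expR (- (t / 2))).
  apply: measurable_funM => //; apply: measurableT_comp => //.
  by apply: measurableT_comp => //; exact: measurable_funM.
rewrite -i2 -ge0_integralZl//; first last.
- by rewrite lee_fin mulr_ge0.
- exact/measurable_EFinP/measurable_funTS.
apply: ge0_le_integral => //.
- by move=> t _; rewrite lee_fin mulr_ge0// powR_ge0.
- apply/measurable_EFinP/measurable_funTS; exact: measurable_powR_expRN.
- by apply/measurable_EFinP/measurable_funTS/measurable_funM.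
- move=> t; rewrite /= in_itv/= andbT => t0.
  rewrite lee_fin addrK mulrA mulfK//.
  rewrite (_ : - t = - (t / 2) + - (t / 2)); last by field.
  rewrite expRD mulrA ler_wpM2r//.
  rewrite expRN ler_pdivrMr ?expR_gt0//.
  (* Both sides become s-th powers, and it suffices to compare the bases. *)
  have -> : expR (t / 2) = expR (t / (2 * s)) `^ s.
    by rewrite -expRM; congr expR; field; rewrite gt_eqF.
  have t2 : 0 <= t / (2 * s) by rewrite divr_ge0 ?mulr_ge0 ?ltW.
  have s2 : 0 <= 2 * s by rewrite mulr_ge0// ltW.
  rewrite -powRM ?expR_ge0//.
  apply: ge0_ler_powR; rewrite ?nnegrE ?(ltW s0) ?(ltW t0)//.
    by rewrite mulr_ge0// expR_ge0.
  rewrite mulrC -ler_pdivrMr ?mulr_gt0//.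
  by apply: le_trans (expR_ge1Dx _); rewrite lerDr.
Unshelve. all: by end_near. Qed.

(** Convergence for 0 < s < 1, where the integrand is singular at 0, is
    inherited from s + 1 through the functional equation. *)
Lemma eGamma_fin_num (s : R) : 0 < s -> eGamma s \is a fin_num.
Proof.
move=> s0; rewrite ge0_fin_numE ?eGamma_ge0// eGammaS//.
by rewrite lte_mul_pinfty// ?lee_fin ?invr_ge0 ?ltW ?eGammaS_lty.
Qed.

Lemma EFin_Gamma (s : R) : 0 < s -> (Gamma s)%:E = eGamma s.
Proof. by move=> s0; rewrite fineK// eGamma_fin_num. Qed.

Lemma GammaS (s : R) : 0 < s -> Gamma (s + 1) = s * Gamma s.
Proof.
move=> s0; apply: EFin_inj; rewrite EFinM !EFin_Gamma ?addr_gt0//.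
by rewrite (eGammaS s0) muleA -EFinM divff ?gt_eqF// mul1e.
Qed.

(** On ]1, +oo[ the integrand is at least exp (- t). *)
Lemma GammaS_gt0 (s : R) : 0 < s -> 0 < Gamma (s + 1).
Proof.
move=> s0; rewrite -lte_fin EFin_Gamma ?addr_gt0//.
apply: (@lt_le_trans _ _ (\int[leb]_(t in `]1%R, +oo[) (expR (- t))%:E)%E).
  by rewrite integral_tail_expR lte_fin expR_gt0.
apply: (@le_trans _ _ (\int[leb]_(t in `]1%R, +oo[)
    (t `^ (s + 1 - 1) * expR (- t))%:E)%E).
  apply: ge0_le_integral => //.
  - by apply/measurable_EFinP/measurable_funTS; exact: measurable_expRN.
  - apply/measurable_EFinP/measurable_funTS; exact: measurable_powR_expRN.
  - move=> t; rewrite /= in_itv/= andbT => t1; rewrite lee_fin addrK ler_peMl//.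
    have -> : 1 = 1 `^ s :> R by rewrite powR1.
    by apply: ge0_ler_powR; rewrite ?nnegrE ?(ltW s0) ?(ltW t1)// (le_trans ler01 (ltW t1)).
apply: ge0_subset_integral => //.
- apply/measurable_EFinP/measurable_funTS; exact: measurable_powR_expRN.
- by move=> t _; rewrite lee_fin mulr_ge0// powR_ge0.
- by apply: subset_itvr; rewrite bnd_simp.
Qed.

End Gamma_function.

(** * Lebesgue measure: dilations and product integrands *)

Section lebesgue_scaling.
Context {R : realType}.
Local Notation leb := (@lebesgue_measure R).

Let scale (c : R) : measurableTypeR R -> measurableTypeR R := fun t => c * t.

Let measurable_scale c : measurable_fun setT (scale c).
Proof. by apply: measurable_funM. Qed.

(** Lebesgue measure is c times its image under t |-> c t, as both agree on
    bounded intervals. *)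
Lemma ge0_integral_lebesgue_scale (c : R) (f : R -> \bar R) : 0 < c ->
  measurable_fun setT f -> (forall t, (0 <= f t)%E) ->
  (\int[leb]_t f (c * t)%R = (c^-1)%:E * \int[leb]_t f t)%E.
Proof.
move=> c0 mf f0.
pose P := measure_function_pushforward__canonical__measure_function_Measure leb
  (measurable_scale c).
have PE A : measurable A -> leb A = mscale (NngNum (ltW c0)) P A.
  apply: lebesgue_measure_unique => _ [[a b]] _ <-.
  transitivity (c%:E * leb (scale c @^-1` `]a, b]))%E => //.
  rewrite (_ : _ @^-1` _ = `]a / c, b / c]%classic); last first.
    by apply/seteqP; split => t; rewrite /scale/= !in_itv/= ltr_pdivrMr// ler_pdivlMr// mulrC.
  rewrite !lebesgue_measure_itv/= !lte_fin ltr_pM2r ?invr_gt0//.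
  case: ifP => _; last by rewrite mule0.
  by rewrite -!EFinD -EFinM; congr EFin; field; rewrite gt_eqF.
transitivity (\int[P]_t f t)%E.
  by rewrite ge0_integral_pushforward.
have -> : (\int[leb]_t f t = \int[mscale (NngNum (ltW c0)) P]_t f t)%E.
  by apply: eq_measure_integral => A mA _; exact: PE.
rewrite ge0_integral_mscale//=.
by rewrite muleA -EFinM mulVf ?gt_eqF// mul1e.
Qed.

End lebesgue_scaling.

Section lebesgueRn_integrals.
Context {R : realType}.
Local Notation leb := (@lebesgue_measure R).

Lemma ge0_integral_lebesgueRnS n (f : n.+1.-tuple R -> \bar R) :
  measurable_fun setT f -> (forall x, (0 <= f x)%E) ->
  (\int[lebesgueRn R n.+1]_x f x =
   \int[leb]_t \int[lebesgueRn R n]_x f (tcons (t, x)))%E.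
Proof.
move=> mf f0.
transitivity (\int[leb \x lebesgueRn R n]_z f (tcons z))%E.
  by rewrite /=; apply: (ge0_integral_pushforward (@measurable_tcons R n)).
apply: fubini_tonelli1 => //.
exact: measurableT_comp mf (@measurable_tcons R n).
Qed.

Lemma measurable_dilate n (c : R) : measurable_fun setT (@dilate R n c).
Proof.
apply/measurable_fun_tnthP => i.
rewrite (_ : _ \o _ = fun x => c * tnth x i); last first.
  by apply/funext => x /=; rewrite tnth_mktuple.
by apply: measurable_funM => //; exact: measurable_tnth.
Qed.

Lemma tnth_tcons0 n (p : R * n.-tuple R) : tnth (tcons p) ord0 = p.1.
Proof. by []. Qed.

Lemma tnth_tconsS n (p : R * n.-tuple R) (i : 'I_n) :
  tnth (tcons p) (lift ord0 i) = tnth p.2 i.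
Proof. by rewrite !(tnth_nth 0). Qed.

Lemma dilate_tcons n (c t : R) (x : n.-tuple R) :
  dilate c (tcons (t, x)) = tcons (c * t, dilate c x).
Proof.
apply/eq_from_tnth => i; rewrite tnth_mktuple.
by case: (unliftP ord0 i) => [j|] ->;
  rewrite ?(tnth_tcons0 (_, _)) ?(tnth_tconsS (_, _))//= tnth_mktuple.
Qed.

Lemma ge0_integral_dilate n (c : R) (f : n.-tuple R -> \bar R) : 0 < c ->
  measurable_fun setT f -> (forall x, (0 <= f x)%E) ->
  (\int[lebesgueRn R n]_x f (dilate c x) =
   (c^-1 ^+ n)%:E * \int[lebesgueRn R n]_x f x)%E.
Proof.
move=> c0; elim: n f => [|n IHn] f mf f0.
  by rewrite expr0 mul1e; apply: eq_integral => x _; rewrite tuple0 [in RHS]tuple0.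
have mfc : measurable_fun setT (fun x => f (dilate c x)).
  exact: measurableT_comp mf (@measurable_dilate _ _).
rewrite !ge0_integral_lebesgueRnS//.
have mft t : measurable_fun setT (fun x => f (tcons (t, x))).
  apply: (measurableT_comp mf).
  by apply: measurable_cons; [exact: measurable_cst|exact: measurable_id].
pose F t := (\int[lebesgueRn R n]_x f (tcons (t, x)))%E.
have mF : measurable_fun setT F.
  apply: (@measurable_fun_fubini_tonelli_F _ _ (measurableTypeR R) _ _
    (lebesgueRn R n) (f \o (@tcons R n))).
  - exact: measurableT_comp mf (@measurable_tcons R n).
  - by move=> z; exact: f0.
have F0 u : (0 <= F u)%E by exact: integral_ge0.
transitivity (\int[leb]_t ((c^-1 ^+ n)%:E * F (c * t)%R))%E.
  apply: eq_integral => t _; rewrite -IHn//.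
  by apply: eq_integral => x _; rewrite dilate_tcons.
rewrite ge0_integralZl//.
- rewrite ge0_integral_lebesgue_scale// muleA -EFinM.
  by rewrite exprSr.
- apply: (measurableT_comp mF); exact: measurable_funM.
- by rewrite lee_fin exprn_ge0// invr_ge0 ltW.
Qed.

(** The integrals are assumed finite so that the product of their values is
    a product of reals. *)
Lemma integral_lebesgueRn_prod n (g : 'I_n -> R -> R) (G : 'I_n -> R) :
  (forall i, measurable_fun setT (g i)) -> (forall i t, 0 <= g i t) ->
  (forall i, (\int[leb]_t (g i t)%:E)%E = (G i)%:E) ->
  (\int[lebesgueRn R n]_x (\prod_(i < n) g i (tnth x i))%:E)%E =
  (\prod_(i < n) G i)%:E.
Proof.
have mp m (h : 'I_m -> R -> R) : (forall i, measurable_fun setT (h i)) ->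
    measurable_fun setT (fun x : m.-tuple R => \prod_(i < m) h i (tnth x i)).
  move=> mh; apply: measurable_prod => i _.
  by apply: (measurableT_comp (mh i)); exact: measurable_tnth.
elim: n g G => [|n IHn] g G mg g0 gG.
  rewrite integral_dirac//; last by apply/measurable_EFinP; exact: mp.
  by rewrite /dirac indicE mem_set// mul1e !big_ord0.
rewrite ge0_integral_lebesgueRnS; last 2 first.
- by apply/measurable_EFinP; exact: mp.
- by move=> x; rewrite lee_fin prodr_ge0.
have G0 i : 0 <= G i.
  by rewrite -lee_fin -gG integral_ge0// => t _; rewrite lee_fin.
transitivity (\int[leb]_t ((g ord0 t)%:E * (\prod_(i < n) G (lift ord0 i))%:E))%E.
  apply: eq_integral => t _.
  rewrite -(IHn (fun i => g (lift ord0 i)))// -ge0_integralZl//; last 3 first.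
  - by apply/measurable_EFinP; exact: (mp _ (fun i => g (lift ord0 i))).
  - by move=> x _; rewrite lee_fin prodr_ge0.
  - by rewrite lee_fin g0.
  apply: eq_integral => x _; rewrite -EFinM big_ord_recl; congr (_ * _)%:E.
  by apply: eq_bigr => i _; rewrite tnth_tconsS.
rewrite ge0_integralZr//; last 3 first.
- by apply/measurable_EFinP; exact: mg.
- by move=> x _; rewrite lee_fin.
- by rewrite lee_fin prodr_ge0.
by rewrite gG -EFinM big_ord_recl.
Qed.

End lebesgueRn_integrals.

(** * Radial integrals against a homogeneous weight *)

Section homogeneity.
Context {R : realType} {n : nat}.
Implicit Types x : n.-tuple R.

Lemma norm2_ge0 x : 0 <= norm2 x.
Proof. exact: sqrtr_ge0. Qed.

Lemma measurable_norm2 : measurable_fun setT (@norm2 R n).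
Proof.
apply: (@measurableT_comp _ _ _ _ _ _ (@Num.sqrt R)).
  by apply: continuous_measurable_fun; exact: sqrt_continuous.
apply: measurable_sum => i.
by apply: measurable_funX; exact: measurable_tnth.
Qed.

Lemma norm2_dilate (c : R) x : 0 <= c -> norm2 (dilate c x) = c * norm2 x.
Proof.
move=> c0; rewrite /norm2 -[in RHS](ger0_norm c0) -sqrtr_sqr -sqrtrM ?sqr_ge0//.
by congr Num.sqrt; rewrite mulr_sumr; apply: eq_bigr => i _; rewrite tnth_mktuple exprMn.
Qed.

Lemma monomialA_dilate (A : n.-tuple R) (c : R) x : 0 < c ->
  monomialA A (dilate c x) = c `^ (\sum_(i < n) tnth A i) * monomialA A x.
Proof.
move=> c0; rewrite /monomialA.
have cE a : c `^ a = expR (a * ln c) by rewrite /powR gt_eqF.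
rewrite cE mulr_suml expR_sum -big_split/=.
by apply: eq_bigr => i _; rewrite -cE tnth_mktuple normrM powRM// gtr0_norm.
Qed.

Lemma orthantA_dilate (A : n.-tuple R) (c : R) x : 0 < c ->
  orthantA A (dilate c x) <-> orthantA A x.
Proof.
by move=> c0; split => + i Ai => /(_ i Ai); rewrite tnth_mktuple pmulr_rgt0.
Qed.

(** Each coordinate constrains x by an open half-space or not at all. *)
Lemma measurable_orthantA (A : n.-tuple R) : measurable (orthantA A).
Proof.
rewrite (_ : orthantA A =
  \bigcap_(i in [set: 'I_n]) [set x | 0 < tnth A i -> 0 < tnth x i]); last first.
  by apply/seteqP; split => [x h i _|x h i]; [exact: h|exact: h].
apply: fin_bigcap_measurable => // i _.
have [Ai|Ai] := ltP 0 (tnth A i); last first.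
  rewrite (_ : [set _ | _] = setT)//.
  by apply/seteqP; split => // x _ /=.
rewrite (_ : [set _ | _] = [set x | 0 < tnth x i]).
  by apply: measurable_set_ltr => //; exact: measurable_tnth.
by apply/seteqP; split => x /=; [exact|].
Qed.

Lemma dimA_gt0 (A : n.-tuple R) : (1 <= n)%N ->
  (forall i, 0 <= tnth A i) -> 0 < dimA A.
Proof.
move=> n1 A0; rewrite /dimA ltr_wpDr ?ltr0n//.
by apply: sumr_ge0 => i _; exact: A0.
Qed.

End homogeneity.

Section radial_integrals.
(** The set S is any measurable cone: the orthant for the inequalities, and
    the whole space for the integrability of the extremal functions. *)
Context {R : realType} {n : nat}.
Variables (A : n.-tuple R) (S : set (n.-tuple R)).
Hypotheses (n_ge1 : (1 <= n)%N) (A_ge0 : forall i, 0 <= tnth A i).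
Hypotheses (mS : measurable S)
  (SZ : forall (c : R) x, 0 < c -> S (dilate c x) <-> S x).
Local Notation leb := (@lebesgue_measure R).
Local Notation lebn := (lebesgueRn R n).
Local Notation D := (dimA A).

Let w x := monomialA A x * \1_S x.

Let w0 x : 0 <= w x.
Proof. by rewrite mulr_ge0// monomialA_ge0. Qed.

Let mw : measurable_fun setT w.
Proof.
apply: measurable_funM; first exact: measurable_monomialA.
exact: measurable_indic.
Qed.

Definition ball_weight (r : R) : \bar R :=
  (\int[lebn]_(x in [set x | (norm2 x < r)%R]) (w x)%:E)%E.

Lemma ball_weight_ge0 r : (0 <= ball_weight r)%E.
Proof. by apply: integral_ge0 => x _; rewrite lee_fin. Qed.

(** Dilating by r contributes r^n from Lebesgue measure and
    r^(A_1 + ... + A_n) from the monomial, and maps S to itself. *)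
Lemma ball_weight_homogeneous (r : R) : 0 < r ->
  ball_weight r = ((r `^ D)%:E * ball_weight 1)%E.
Proof.
move=> r0; have bE s : ball_weight s =
    (\int[lebn]_x (w x * \1_[set x | (norm2 x < s)%R] x)%:E)%E.
  exact: integral_mul_indic.
rewrite !bE.
have mf s : measurable_fun setT (fun x : n.-tuple R =>
    (w x * \1_[set x | norm2 x < s] x)%:E).
  apply/measurable_EFinP; apply: measurable_funM => //; apply: measurable_indic.
  by apply: measurable_set_ltr => //; exact: measurable_norm2.
have f0 s x : (0 <= (w x * \1_[set x | norm2 x < s] x)%:E)%E.
  by rewrite lee_fin mulr_ge0.
have /(congr1 (fun y => (r ^+ n)%:E * y)%E) := ge0_integral_dilate r0 (mf r) (f0 r).
rewrite [RHS]muleA -EFinM exprVn divff ?mul1e ?gt_eqF ?exprn_gt0// => <-.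
rewrite (_ : r `^ D = r ^+ n * r `^ (\sum_(i < n) tnth A i)); last first.
  rewrite /dimA powRD; last by rewrite (gt_eqF r0) implybT.
  by rewrite powR_mulrn// ltW.
rewrite EFinM -muleA; congr (_ * _)%E; rewrite -ge0_integralZl//; last first.
  by rewrite lee_fin powR_ge0.
apply: eq_integral => x _.
rewrite -EFinM /w monomialA_dilate// -!mulrA; congr (_ * (_ * _))%:E.
rewrite !indicE -!natrM !mulnb; congr (nat_of_bool _)%:R.
congr (_ && _).
  by apply/idP/idP => /set_mem/(SZ x r0)/mem_set.
apply/idP/idP => /set_mem/=; rewrite ?norm2_dilate ?(ltW r0)// => h;
  apply/mem_set; move: h; rewrite /= ?norm2_dilate ?(ltW r0)//.
  by rewrite -ltr_pdivlMl// mulVf// gt_eqF.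
by rewrite -ltr_pdivlMl// mulVf// gt_eqF.
Qed.

(** The region c |x|^alpha < t is the ball of radius (t / c)^(1 / alpha), of
    weight proportional to (t / c)^(D / alpha). *)
Lemma layer_cake_radial (alpha c : R) (g : R -> R) : 0 < alpha -> 0 < c ->
  measurable_fun setT g -> (forall t, 0 < t -> 0 <= g t) ->
  (\int[lebn]_x ((w x)%:E *
     \int[leb]_(t in `](c * norm2 x `^ alpha)%R, +oo[) (g t)%:E) =
   (c `^ (- (D / alpha)))%:E * ball_weight 1 *
     \int[leb]_(t in `]0%R, +oo[) (t `^ (D / alpha) * g t)%:E)%E.
Proof.
move=> al0 c0 mg g0.
have D0 : 0 < D by exact: dimA_gt0.
rewrite layer_cake//; last 2 first.
- apply: measurable_funM => //.
  by apply: (@measurableT_comp _ _ _ _ _ _ (@powR R ^~ alpha));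
    [exact: measurable_powR|exact: measurable_norm2].
- by move=> x; rewrite mulr_ge0 ?powR_ge0// ltW.
transitivity (\int[leb]_(t in `]0%R, +oo[)
   (((c `^ (- (D / alpha)))%:E * ball_weight 1) * (t `^ (D / alpha) * g t)%:E))%E.
  apply: eq_integral => t; rewrite inE/= in_itv/= andbT => t0.
  have tc0 : 0 <= t / c by rewrite divr_ge0 ?ltW.
  rewrite (_ : [set x | _] = [set x | norm2 x < (t / c) `^ alpha^-1]); last first.
    have e u : 0 <= u -> (u `^ alpha) `^ alpha^-1 = u.
      by move=> u0; rewrite -powRrM divff ?gt_eqF// powRr1.
    have e' u : 0 <= u -> (u `^ alpha^-1) `^ alpha = u.
      by move=> u0; rewrite -powRrM mulVf ?gt_eqF// powRr1.
    apply/seteqP; split => x /=; rewrite -ltr_pdivlMl// [c^-1 * t]mulrC => h.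
      rewrite -(e _ (norm2_ge0 x)).
      by apply: gt0_ltr_powR; rewrite ?invr_gt0// nnegrE powR_ge0.
    rewrite -(e' _ tc0).
    by apply: gt0_ltr_powR; rewrite ?nnegrE ?norm2_ge0 ?powR_ge0.
  rewrite -/(ball_weight _) ball_weight_homogeneous ?powR_gt0 ?divr_gt0//.
  rewrite muleA [RHS]muleC muleA -!EFinM; congr (_%:E * _)%E.
  rewrite -powRrM powRM ?invr_ge0 ?(ltW t0) ?(ltW c0)//.
  rewrite -[c^-1]powR_inv1 ?(ltW c0)// -powRrM mulN1r.
  by rewrite [alpha^-1 * D]mulrC; ring.
have mh : measurable_fun setT (fun t : R => t `^ (D / alpha) * g t).
  by apply: measurable_funM => //; exact: measurable_powR.
apply: ge0_integralZl => //.
- exact/measurable_EFinP/measurable_funTS.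
- by move=> t; rewrite /= in_itv/= andbT => t0; rewrite lee_fin mulr_ge0 ?powR_ge0 ?g0.
- by rewrite mule_ge0 ?ball_weight_ge0// lee_fin powR_ge0.
Qed.

Lemma integral_radial_expR (alpha c : R) : 0 < alpha -> 0 < c ->
  (\int[lebn]_x (w x * expR (- (c * norm2 x `^ alpha)))%:E =
   (c `^ (- (D / alpha)))%:E * ball_weight 1 * (Gamma (D / alpha + 1))%:E)%E.
Proof.
move=> al0 c0; have s0 : 0 < D / alpha by rewrite divr_gt0// dimA_gt0.
rewrite EFin_Gamma ?addr_gt0// /eGamma addrK.
rewrite -layer_cake_radial//; last exact: measurable_expRN.
by apply: eq_integral => x _; rewrite integral_tail_expR EFinM.
Qed.

Lemma integral_radial_id_expR (alpha c : R) : 0 < alpha -> 0 < c ->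
  (\int[lebn]_x (w x * ((c * norm2 x `^ alpha + 1) *
      expR (- (c * norm2 x `^ alpha))))%:E =
   (c `^ (- (D / alpha)))%:E * ball_weight 1 *
     ((D / alpha + 1) * Gamma (D / alpha + 1))%:E)%E.
Proof.
move=> al0 c0; have s0 : 0 < D / alpha by rewrite divr_gt0// dimA_gt0.
rewrite -GammaS ?addr_gt0// EFin_Gamma ?addr_gt0// /eGamma addrK.
under [in RHS]eq_integral => t.
  rewrite inE/= in_itv/= andbT => t0.
  rewrite powRD ?(gt_eqF t0) ?implybT// powRr1 ?(ltW t0)// -mulrA.
  over.
rewrite -layer_cake_radial//; last 2 first.
- by apply: measurable_funM => //; exact: measurable_expRN.
- by move=> t t0; rewrite mulr_ge0// ltW.
apply: eq_integral => x _; rewrite integral_tail_id_expR ?EFinM//.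
by rewrite mulr_ge0 ?powR_ge0// ltW.
Qed.

(** Integrating exp (- |x|^2) radially gives the weight of the unit ball times
    Gamma (D / 2 + 1); this is solved for the weight. *)
Lemma ball_weight1E (G : R) :
  (\int[lebn]_x (w x * expR (- (norm2 x ^+ 2)))%:E = G%:E)%E ->
  ball_weight 1 = (G / Gamma (D / 2 + 1))%:E.
Proof.
move=> GE; have D0 : 0 < D by exact: dimA_gt0.
have Ga0 : 0 < Gamma (D / 2 + 1) by rewrite GammaS_gt0// divr_gt0.
have := @integral_radial_expR 2 1 (ltr0n R 2) ltr01.
rewrite powR1 mul1e.
under eq_integral do rewrite mul1r powR_mulrn ?norm2_ge0//.
rewrite GE => /(congr1 (fun y => y * ((Gamma (D / 2 + 1))^-1)%:E)%E).
by rewrite -muleA -!EFinM divff ?gt_eqF// mule1.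
Qed.

End radial_integrals.

(** * Gaussian integrals against the monomial weight *)

Section gaussian_moments.
Context {R : realType}.
Local Notation leb := (@lebesgue_measure R).

Lemma Gamma_gt0 (s : R) : 0 < s -> 0 < Gamma s.
Proof. by move=> s0; rewrite -(pmulr_rgt0 _ s0) -GammaS// GammaS_gt0. Qed.

Lemma measurable_gaussian_moment (a : R) :
  measurable_fun setT (fun t : R => `|t| `^ a * expR (- (t ^+ 2))).
Proof.
apply: measurable_funM.
  apply: (@measurableT_comp _ _ _ _ _ _ (@powR R ^~ a)).
    exact: measurable_powR.
  exact: normr_measurable.
exact: measurable_gauss_fun.
Qed.

(** From integral_powR_expR with p = 2 and s = a + 1, after
    Gamma (s / 2 + 1) = (s / 2) Gamma (s / 2). *)
Lemma integral_gaussian_moment_half (a : R) : 0 <= a ->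
  (\int[leb]_(t in `]0%R, +oo[) (`|t| `^ a * expR (- (t ^+ 2)))%:E =
   (Gamma ((a + 1) / 2) / 2)%:E)%E.
Proof.
move=> a0; have a1 : 0 < a + 1 by rewrite ltr_wpDl.
have a2 : 0 < (a + 1) / 2 by rewrite divr_gt0.
have := integral_powR_expR (ltr0n R 2) a1.
rewrite -EFin_Gamma ?addr_gt0// GammaS// => e.
rewrite (_ : _ / 2 = (a + 1)^-1 * ((a + 1) / 2 * Gamma ((a + 1) / 2))); last first.
  by field; rewrite gt_eqF.
rewrite EFinM -e; apply: eq_integral => t; rewrite inE/= in_itv/= andbT => t0.
by rewrite addrK gtr0_norm// powR_mulrn// ltW.
Qed.

Lemma integral_gaussian_moment (a : R) : 0 <= a ->
  (\int[leb]_t (`|t| `^ a * expR (- (t ^+ 2)))%:E = (Gamma ((a + 1) / 2))%:E)%E.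
Proof.
move=> a0; pose f (t : R) : \bar R := (`|t| `^ a * expR (- (t ^+ 2)))%:E.
have mf : measurable_fun setT f.
  by apply/measurable_EFinP; exact: measurable_gaussian_moment.
have f0 t : (0 <= f t)%E by rewrite lee_fin mulr_ge0// powR_ge0.
have fN t : f (- t) = f t by rewrite /f normrN sqrrN.
rewrite -/f (_ : setT = `]-oo, 0%R] `|` `]0%R, +oo[); last first.
  by apply/seteqP; split => t //= _; rewrite !in_itv/= andbT; case: ltP; [right|left].
rewrite ge0_integral_setU//=; last 2 first.
- exact: measurable_funTS.
- rewrite disj_set2E; apply/eqP/seteqP; split => t //=.
  by rewrite !in_itv/= andbT ltNge => -[->].
rewrite (_ : (\int[leb]_(t in `]-oo, 0%R]) f t =
    \int[leb]_(t in `]0%R, +oo[) f t)%E); last first.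
  under eq_integral do rewrite -fN.
  rewrite -ge0_integration_by_substitution0//.
  by rewrite integral_itv_obnd_cbnd//; exact: measurable_funTS.
rewrite integral_gaussian_moment_half// -EFinD; congr EFin.
by field.
Qed.

Lemma integral_gaussian_moment_orthant (a : R) : 0 <= a ->
  (\int[leb]_t (`|t| `^ a * expR (- (t ^+ 2)) * \1_[set t | (0 < a -> 0 < t)%R] t)%:E =
   ((if (0 < a)%R then 2^-1 else 1) * Gamma ((a + 1) / 2))%:E)%E.
Proof.
move=> a0; rewrite -integral_mul_indic; have [a1|a1] := ltP 0 a.
  rewrite mulrC -integral_gaussian_moment_half//.
  rewrite (_ : [set _ | _] = `]0, +oo[%classic)//.
  by apply/seteqP; split => t /=; rewrite in_itv/= andbT// => ->.
rewrite mul1r -integral_gaussian_moment//.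
rewrite (_ : [set _ | _] = setT)//.
by apply/seteqP; split => t.
Qed.

Context {n : nat}.
Local Notation lebn := (lebesgueRn R n).
Variables (A : n.-tuple R) (A_ge0 : forall i, 0 <= tnth A i).

Lemma gaussian_prod (x : n.-tuple R) :
  monomialA A x * expR (- (norm2 x ^+ 2)) =
  \prod_(i < n) (`|tnth x i| `^ tnth A i * expR (- (tnth x i ^+ 2))).
Proof.
rewrite /norm2 sqr_sqrtr; last by apply: sumr_ge0 => i _; exact: sqr_ge0.
by rewrite -sumrN expR_sum -big_split.
Qed.

Lemma integral_gaussian :
  (\int[lebn]_x (monomialA A x * \1_setT x * expR (- (norm2 x ^+ 2)))%:E =
   (\prod_(i < n) Gamma ((tnth A i + 1) / 2))%:E)%E.
Proof.
under eq_integral do rewrite indicT mulr1 gaussian_prod.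
apply: (@integral_lebesgueRn_prod _ _
  (fun i t => `|t| `^ tnth A i * expR (- (t ^+ 2)))) => [i|i t|i].
- exact: measurable_gaussian_moment.
- by rewrite mulr_ge0// powR_ge0.
- exact: integral_gaussian_moment.
Qed.

(** Tonelli reduces to the coordinates; those with A_i > 0 range over a
    half-line and each contributes a factor 1/2, whence the power of 2. *)
Lemma integral_gaussian_orthant :
  (\int[lebn]_x (monomialA A x * \1_(orthantA A) x * expR (- (norm2 x ^+ 2)))%:E =
   ((2 ^+ #|[pred i : 'I_n | (0 < tnth A i)%R]|)^-1 *
    \prod_(i < n) Gamma ((tnth A i + 1) / 2))%:E)%E.
Proof.
have indE x : \1_(orthantA A) x =
    \prod_(i < n) \1_[set t : R | 0 < tnth A i -> 0 < t] (tnth x i) :> R.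
  have [xA|xA] := pselect (orthantA A x).
    rewrite indicE mem_set// big1// => i _; rewrite indicE mem_set//.
    exact: xA.
  rewrite indicE memNset//; apply/esym/eqP/prodf_eq0.
  have /existsNP[i /not_implyP[Ai xi]] := xA.
  exists i => //; rewrite indicE memNset//= => h.
  exact/xi/h.
transitivity (\int[lebn]_x (\prod_(i < n) (`|tnth x i| `^ tnth A i *
    expR (- (tnth x i ^+ 2)) *
    \1_[set t : R | (0 < tnth A i -> 0 < t)%R] (tnth x i)))%:E)%E.
  apply: eq_integral => x _.
  by rewrite big_split/= -gaussian_prod -indE mulrAC.
rewrite (@integral_lebesgueRn_prod _ _
  (fun i t => `|t| `^ tnth A i * expR (- (t ^+ 2)) *
    \1_[set t : R | (0 < tnth A i -> 0 < t)%R] t)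
  (fun i => (if (0 < tnth A i)%R then 2^-1 else 1) *
     Gamma ((tnth A i + 1) / 2))) => [|i|i t|i].
- rewrite big_split/= -big_mkcond/= prodr_const exprVn.
  by congr (_^-1 * _)%:E.
- apply: measurable_funM; first exact: measurable_gaussian_moment.
  apply: measurable_indic.
  have [a1|a1] := ltP 0 (tnth A i).
    rewrite (_ : [set _ | _] = `]0, +oo[%classic)//.
    by apply/seteqP; split => t /=; rewrite in_itv/= andbT// => ->.
  rewrite (_ : [set _ | _] = setT)//.
  by apply/seteqP; split => t.
- by rewrite !mulr_ge0// powR_ge0.
- exact: integral_gaussian_moment_orthant.
Qed.

End gaussian_moments.

(** * Integration against a measure with a density *)

Section density.
Local Open Scope ereal_scope.
Context d (T : measurableType d) (R : realType).
Variables (mu nu : {measure set T -> \bar R}) (w : T -> R).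
Hypotheses (mw : measurable_fun setT w) (w0 : forall x, (0 <= w x)%R).
Hypothesis nuE : forall B, measurable B -> nu B = \int[mu]_(x in B) (w x)%:E.

Import HBNNSimple.

Let mEw : measurable_fun setT (fun x => (w x)%:E).
Proof. exact/measurable_EFinP. Qed.

Let density_nnsfun (h : {nnsfun T >-> R}) :
  \int[nu]_x (h x)%:E = \int[mu]_x ((h x)%:E * (w x)%:E).
Proof.
have mind r : measurable_fun setT (fun x => (r * \1_(h @^-1` [set r]) x)%:E).
  by apply/measurable_EFinP; exact: measurable_funM.
transitivity (\int[nu]_x
   (\sum_(y \in range h) (y * \1_(h @^-1` [set y]) x)%:E)).
  by apply: eq_integral => t _; rewrite /= fimfunE -fsumEFin.
rewrite ge0_integral_fsum//; last by move=> m y _; exact: nnfun_muleindic_ge0.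
transitivity (\int[mu]_x (\sum_(y \in range h)
    (y * \1_(h @^-1` [set y]) x)%:E * (w x)%:E)); last first.
  apply: eq_integral => x _.
  rewrite -ge0_mule_fsuml => [|y]; last exact: nnfun_muleindic_ge0.
  by rewrite fsumEFin // -(fimfunE _ x).
rewrite ge0_integral_fsum//; last 2 first.
- by move=> y; exact: emeasurable_funM.
- by move=> m y _; apply: mule_ge0; [exact: nnfun_muleindic_ge0|rewrite lee_fin].
apply: eq_fsbigr => r _.
under eq_integral do rewrite EFinM.
rewrite integralZl_indic_nnsfun//.
under [RHS]eq_integral do rewrite EFinM -muleA.
have mp : measurable (h @^-1` [set r]) by exact: measurable_sfunP.
rewrite integral_indic// setIT nuE// integral_mul_indic.
have [->|r0] := eqVneq r 0%R.
  rewrite mul0e; apply/esym/integral0_eq => x _; exact: mul0e.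
have [rge0|rlt0] := leP 0%R r.
  rewrite ge0_integralZl//; last 2 first.
  - by apply: emeasurable_funM => //; apply/measurable_EFinP; exact: measurable_indic.
  - by move=> x _; rewrite mule_ge0// lee_fin.
  by congr (_ * _); apply: eq_integral => x _; rewrite EFinM muleC.
rewrite (_ : h @^-1` [set r] = set0); last first.
  apply/seteqP; split => // x /= hx; have : (0 <= h x)%R by exact: fun_ge0.
  by rewrite hx leNgt rlt0.
rewrite !integral0_eq ?mule0// => x _; rewrite indic0 ?mulr0 ?mul0e ?mule0//.
Qed.

(** True by hypothesis for indicators, hence for simple functions by
    linearity, hence in general by monotone convergence. *)
Lemma ge0_integral_density (f : T -> \bar R) :
  measurable_fun setT f -> (forall x, 0 <= f x) ->
  \int[nu]_x f x = \int[mu]_x (f x * (w x)%:E).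
Proof.
move=> mf f0; pose h := nnsfun_approx measurableT mf.
have -> : \int[nu]_x f x = lim (\int[nu]_x (EFin \o h n) x @[n --> \oo]).
  rewrite -monotone_convergence//.
  - apply: eq_integral => x _; apply/esym/cvg_lim => //.
    exact: cvg_nnsfun_approx.
  - by move=> n; exact/measurable_EFinP.
  - by move=> n x _ //=; rewrite lee_fin.
  - by move=> x _ a b ab; rewrite lee_fin; exact/lefP/nd_nnsfun_approx.
have -> : \int[mu]_x (f x * (w x)%:E) =
    lim (\int[mu]_x ((EFin \o h n) x * (w x)%:E) @[n --> \oo]).
  rewrite -monotone_convergence//.
  - apply: eq_integral => x _; apply/esym/cvg_lim => //.
    by apply: cvgeZr => //; exact: cvg_nnsfun_approx.
  - by move=> n; apply: emeasurable_funM => //; exact/measurable_EFinP.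
  - by move=> n x _; rewrite mule_ge0// lee_fin.
  - move=> x _ a b ab/=; rewrite lee_wpmul2r ?lee_fin//.
    exact/lefP/nd_nnsfun_approx.
by under eq_fun do rewrite density_nnsfun.
Qed.

End density.

Lemma integral_measureA (R : realType) (n : nat) (A : n.-tuple R)
    (S : set (n.-tuple R)) (h : n.-tuple R -> R) :
  measurable S -> measurable_fun setT h -> (forall x, 0 <= h x) ->
  (\int[measureA A]_(x in S) (h x)%:E =
   \int[lebesgueRn R n]_x (monomialA A x * \1_S x * h x)%:E)%E.
Proof.
move=> mS mh h0; rewrite integral_mul_indic.
rewrite (@ge0_integral_density _ _ _ (lebesgueRn R n) _ (monomialA A)); last 5 first.
- exact: measurable_monomialA.
- exact: monomialA_ge0.
- by [].
- apply/measurable_EFinP; apply: measurable_funM; first exact: mh.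
  exact: measurable_indic.
- by move=> x; rewrite lee_fin mulr_ge0.
by apply: eq_integral => x _; rewrite -EFinM; congr EFin; ring.
Qed.

(** * Gibbs' inequality *)

Section gibbs.
Context d (T : measurableType d) (R : realType).
Variables (mu : {measure set T -> \bar R}) (D : set T) (mD : measurable D).

(** Holds without integrability: the positive parts compare in one direction,
    the negative parts in the other, and both differences follow the convention
    +oo - +oo = -oo. *)
Lemma le_integral_measurable (f g : T -> \bar R) :
  measurable_fun D f -> measurable_fun D g ->
  (forall x, D x -> (f x <= g x)%E) ->
  (\int[mu]_(x in D) f x <= \int[mu]_(x in D) g x)%E.
Proof.
move=> mf mg fg; rewrite integralE [leRHS]integralE leeB//.
- apply: ge0_le_integral => //.
  + exact: measurable_funepos.
  + exact: measurable_funepos.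
  + by move=> x Dx; apply: (@funepos_le _ _ D) => [y /set_mem/fg//|]; exact/mem_set.
- apply: ge0_le_integral => //.
  + exact: measurable_funeneg.
  + exact: measurable_funeneg.
  + by move=> x Dx; apply: (@funeneg_le _ _ D) => [y /set_mem/fg//|]; exact/mem_set.
Qed.

(** For y > 0, the inequality ln z <= z - 1 at z = exp (- p) / y, multiplied
    by y. *)
Lemma mul_ln_ge (y p : R) : 0 <= y -> y - expR (- p) - y * p <= y * ln y.
Proof.
rewrite le_eqVlt => /predU1P[<-|y0].
  by rewrite !mul0r subr0 sub0r oppr_le0 expR_ge0.
have q0 : 0 < expR (- p) / y by rewrite divr_gt0// expR_gt0.
have := @le_ln1Dx _ (expR (- p) / y - 1).
rewrite ltrBrDl subrr q0 => /(_ isT).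
rewrite subrKC ln_div ?posrE ?expR_gt0// expRK.
move=> /(ler_wpM2l (ltW y0)); rewrite 2!mulrBr mulr1 mulrN.
by rewrite [y * (_ / y)]mulrC divfK ?gt_eqF//; lra.
Qed.

(** Integrate mul_ln_ge: the two masses cancel. The lower bound of f ln f is
    integrable, so the integral of f ln f is well defined, possibly +oo. *)
Lemma gibbs_inequality (f p : T -> R) : measurable_fun D f -> measurable_fun D p ->
  (forall x, 0 <= f x) ->
  (\int[mu]_(x in D) (f x)%:E = 1)%E ->
  (\int[mu]_(x in D) (expR (- p x))%:E = 1)%E ->
  mu.-integrable D (fun x => (f x * p x)%:E) ->
  (- (\int[mu]_(x in D) (f x * ln (f x))%:E) <=
   \int[mu]_(x in D) (f x * p x)%:E)%E.
Proof.
move=> mf mp f0 f1 p1 ifp.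
have ge0_int (g : T -> R) : measurable_fun D g -> (forall x, 0 <= g x) ->
    (\int[mu]_(x in D) (g x)%:E = 1)%E -> mu.-integrable D (EFin \o g).
  move=> mg g0 g1; apply/integrableP; split; first exact/measurable_EFinP.
  under eq_integral do rewrite /= ger0_norm//.
  by rewrite g1 ltry.
have mep : measurable_fun D (fun x => expR (- p x)).
  by do 2 apply: measurableT_comp => //.
have iff : mu.-integrable D (EFin \o f) by exact: ge0_int.
have ie : mu.-integrable D (EFin \o (fun x => expR (- p x))).
  by apply: ge0_int => // x; exact: expR_ge0.
rewrite leeNl.
apply: (@le_trans _ _ (\int[mu]_(x in D) (f x - expR (- p x) - f x * p x)%:E)%E).
  rewrite [leRHS](integralB_EFin mD (integrableB mD iff ie) ifp).
  by rewrite [X in (_ <= X - _)%E](integralB_EFin mD iff ie) f1 p1 subee// sub0e.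
apply: le_integral_measurable.
- apply/measurable_EFinP; apply: measurable_funB; last exact: measurable_funM.
  exact: measurable_funB.
- apply/measurable_EFinP; apply: measurable_funM => //.
  by apply: measurableT_comp => //; exact: measurable_ln.
- by move=> x _; rewrite lee_fin mul_ln_ge.
Qed.

End gibbs.

(** * Sharp entropy bounds on the orthant *)

Section entropy.
Context {R : realType} {n : nat}.
Variables (A : n.-tuple R).
Hypotheses (n_ge1 : (1 <= n)%N) (A_ge0 : forall i, 0 <= tnth A i).
Local Notation D := (dimA A).
Local Notation nu := (measureA A).
Local Notation O := (orthantA A).

Let D0 : 0 < D. Proof. exact: dimA_gt0. Qed.

Let mO : measurable O. Proof. exact: measurable_orthantA. Qed.

Let OZ (c : R) x : 0 < c -> O (dilate c x) <-> O x.
Proof. exact: orthantA_dilate. Qed.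

(** The Gaussian integral over the orthant in the normalization PiA. *)
Lemma PiA_powR : PiA A `^ (D / 2) =
  (2 ^+ #|[pred i : 'I_n | 0 < tnth A i]|)^-1 *
    \prod_(i < n) Gamma ((tnth A i + 1) / 2).
Proof.
rewrite /PiA -powRrM (_ : 2 / D * (D / 2) = 1); last by field; rewrite gt_eqF.
rewrite powRr1// mulr_ge0//.
apply: prodr_ge0 => i _; apply/ltW/Gamma_gt0.
by rewrite divr_gt0// ltr_wpDl.
Qed.

Lemma PiA_powR_gt0 : 0 < PiA A `^ (D / 2).
Proof.
rewrite PiA_powR mulr_gt0//.
apply: prodr_gt0 => i _; apply/Gamma_gt0.
by rewrite divr_gt0// ltr_wpDl.
Qed.

(** CA is normalized so that its power D / alpha is the integral of
    exp (- |x|^alpha) over the orthant. *)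
Lemma CA_powR (alpha : R) : 0 < alpha -> CA A alpha `^ (D / alpha) =
  Gamma (D / alpha + 1) / Gamma (D / 2 + 1) * PiA A `^ (D / 2).
Proof.
move=> al0; rewrite {1}/CA -powRrM.
rewrite (_ : alpha / D * (D / alpha) = 1); last by field; rewrite !gt_eqF.
by rewrite powRr1// mulr_ge0 ?powR_ge0// divr_ge0// ltW// GammaS_gt0// divr_gt0.
Qed.

Lemma CA_gt0 (alpha : R) : 0 < alpha -> 0 < CA A alpha.
Proof.
move=> al0; rewrite powR_gt0// mulr_gt0 ?PiA_powR_gt0//.
by rewrite divr_gt0// GammaS_gt0// divr_gt0.
Qed.

Lemma CA2 : CA A 2 = PiA A.
Proof.
rewrite /CA divff ?gt_eqF ?GammaS_gt0 ?divr_gt0// mul1r -powRrM.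
rewrite (_ : D / 2 * (2 / D) = 1); last by field; rewrite gt_eqF.
by rewrite powRr1// powR_ge0.
Qed.

Lemma measurable_radial (alpha c : R) :
  measurable_fun setT (fun x : n.-tuple R => c * norm2 x `^ alpha).
Proof.
apply: measurable_funM => //.
apply: (@measurableT_comp _ _ _ _ _ _ (@powR R ^~ alpha)).
  exact: measurable_powR.
exact: measurable_norm2.
Qed.

Lemma measurable_radial_expR (alpha c : R) :
  measurable_fun setT (fun x : n.-tuple R => expR (- (c * norm2 x `^ alpha))).
Proof. by do 2 apply: measurableT_comp => //; exact: measurable_radial. Qed.

Lemma integral_orthant_expR (alpha c : R) : 0 < alpha -> 0 < c ->
  (\int[nu]_(x in O) (expR (- (c * norm2 x `^ alpha)))%:E =
   ((CA A alpha / c) `^ (D / alpha))%:E)%E.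
Proof.
move=> al0 c0; rewrite integral_measureA//; last exact: measurable_radial_expR.
rewrite integral_radial_expR//.
rewrite (ball_weight1E n_ge1 A_ge0 mO OZ (integral_gaussian_orthant A_ge0)).
rewrite -!EFinM; congr EFin.
rewrite powRM ?(ltW (CA_gt0 _)) ?invr_ge0 ?(ltW c0)// CA_powR// PiA_powR.
rewrite -[c^-1]powR_inv1 ?(ltW c0)// -powRrM mulN1r.
by ring.
Qed.

Lemma integral_orthant_id_expR (alpha c : R) : 0 < alpha -> 0 < c ->
  (\int[nu]_(x in O) ((c * norm2 x `^ alpha + 1) *
      expR (- (c * norm2 x `^ alpha)))%:E =
   ((D / alpha + 1) * (CA A alpha / c) `^ (D / alpha))%:E)%E.
Proof.
move=> al0 c0; rewrite integral_measureA//; last 2 first.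
- apply: measurable_funM; last exact: measurable_radial_expR.
  by apply: measurable_funD => //; exact: measurable_radial.
- by move=> x; rewrite mulr_ge0// addr_ge0// mulr_ge0 ?powR_ge0// ltW.
rewrite integral_radial_id_expR//.
rewrite (ball_weight1E n_ge1 A_ge0 mO OZ (integral_gaussian_orthant A_ge0)).
rewrite -!EFinM; congr EFin.
rewrite powRM ?(ltW (CA_gt0 _)) ?invr_ge0 ?(ltW c0)// CA_powR// PiA_powR.
rewrite -[c^-1]powR_inv1 ?(ltW c0)// -powRrM mulN1r.
by ring.
Qed.

Lemma integral_expR_lty (alpha c : R) : 0 < alpha -> 0 < c ->
  (\int[nu]_x (expR (- (c * norm2 x `^ alpha)))%:E < +oo)%E.
Proof.
move=> al0 c0; rewrite integral_measureA//; last exact: measurable_radial_expR.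
rewrite integral_radial_expR//.
rewrite (ball_weight1E n_ge1 A_ge0 measurableT _ (integral_gaussian A_ge0))//.
by rewrite -!EFinM ltry.
Qed.

Section bound.
Variables (alpha : R) (f : n.-tuple R -> R).
Hypotheses (alpha_gt0 : 0 < alpha) (mf : measurable_fun setT f)
  (f_ge0 : forall x, 0 <= f x)
  (f1 : (\int[nu]_(x in O) (f x)%:E = 1)%E)
  (fM : (\int[nu]_(x in O) (f x * norm2 x `^ alpha)%:E < +oo)%E).
Let M := (\int[nu]_(x in O) (f x * norm2 x `^ alpha))%R.
Local Notation s := (D / alpha).
Local Notation C := (CA A alpha).

Let s0 : 0 < s. Proof. exact: divr_gt0. Qed.

Let ME : (\int[nu]_(x in O) (f x * norm2 x `^ alpha)%:E = M%:E)%E.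
Proof.
rewrite fineK// ge0_fin_numE//; apply: integral_ge0 => x _.
by rewrite lee_fin mulr_ge0// powR_ge0.
Qed.

Let M0 : 0 <= M.
Proof. by apply: Rintegral_ge0 => x _; rewrite mulr_ge0// powR_ge0. Qed.

(** Gibbs' inequality for the probability density exp (- p x), where
    p x = b |x|^alpha + (D / alpha) ln (C / b). *)
Lemma entropy_le_linear (b : R) : 0 < b ->
  (- (\int[nu]_(x in O) (f x * ln (f x))%:E) <= (b * M + s * ln (C / b))%:E)%E.
Proof.
move=> b0; have C0 : 0 < C by exact: CA_gt0.
have Cb0 : 0 < C / b by rewrite divr_gt0.
(* exp (- k) is the constant that gives exp (- b |x|^alpha) mass 1. *)
pose k := s * ln (C / b).
have i1 : nu.-integrable O (fun x => (f x)%:E).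
  apply/integrableP; split; first exact/measurable_EFinP/measurable_funTS.
  by under eq_integral do rewrite /= ger0_norm//; rewrite f1 ltry.
have mfr : measurable_fun setT (fun x => f x * norm2 x `^ alpha).
  apply: measurable_funM => //.
  by have := measurable_radial alpha 1; under eq_fun do rewrite mul1r.
have i2 : nu.-integrable O (fun x => (f x * norm2 x `^ alpha)%:E).
  apply/integrableP; split; first exact/measurable_EFinP/measurable_funTS.
  under eq_integral do rewrite /= ger0_norm ?mulr_ge0 ?powR_ge0//.
  by rewrite ME ltry.
have pE x : (f x * (b * norm2 x `^ alpha + k))%:E =
    (b%:E * (f x * norm2 x `^ alpha)%:E + k%:E * (f x)%:E)%E.
  by rewrite -!EFinM -EFinD; congr EFin; ring.
have i3 : nu.-integrable O (fun x => (f x * (b * norm2 x `^ alpha + k))%:E).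
  apply: (@eq_integrable _ _ _ _ _ mO
    (fun x => b%:E * (f x * norm2 x `^ alpha)%:E + k%:E * (f x)%:E)%E).
    by move=> x _; rewrite pE.
  by apply: integrableD => //; exact: integrableZl.
have -> : ((b * M + s * ln (C / b))%:E =
    \int[nu]_(x in O) (f x * (b * norm2 x `^ alpha + k))%:E)%E.
  under eq_integral do rewrite pE.
  rewrite integralD//; [|exact: integrableZl|exact: integrableZl].
  by rewrite !integralZl// ME f1 mule1.
have mk : measurable_fun setT (fun x : n.-tuple R => b * norm2 x `^ alpha + k).
  by apply: measurable_funD => //; exact: measurable_radial.
apply: gibbs_inequality => //.
- exact: measurable_funTS.
- exact: measurable_funTS.
under eq_integral do rewrite opprD expRD mulrC EFinM.
rewrite ge0_integralZl//; last first.
  by apply/measurable_EFinP/measurable_funTS; exact: measurable_radial_expR.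
rewrite integral_orthant_expR// -EFinM; congr EFin.
by rewrite /powR gt_eqF// -expRD addNr expR0.
Qed.

(** Optimization in b. When M = 0, taking b = C bounds the entropy by 0, which
    is the value of the right-hand side since ln 0 = 0. *)
Lemma entropy_le : (- (\int[nu]_(x in O) (f x * ln (f x))%:E) <=
  (s * ln (alpha * C * expR 1 / D * M))%:E)%E.
Proof.
have C0 : 0 < C by exact: CA_gt0.
have [M_eq0|M_neq0] := eqVneq M 0.
  have := entropy_le_linear C0.
  by rewrite M_eq0 !mulr0 divff ?gt_eqF// ln1 ln0// mulr0 addr0.
have M_gt0 : 0 < M by rewrite lt_neqAle eq_sym M_neq0 M0.
(* s / M is the minimizer of b |-> b M + s ln (C / b). *)
have sM0 : 0 < s / M by rewrite divr_gt0.
apply: (le_trans (entropy_le_linear sM0)); rewrite lee_fin.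
rewrite divfK// (_ : alpha * C * expR 1 / D * M = expR 1 * (C / (s / M))); last first.
  by field; rewrite !gt_eqF.
by rewrite [ln (expR 1 * _)]lnM ?posrE ?expR_gt0 ?divr_gt0// expRK mulrDr mulr1.
Qed.

End bound.

Section extremal.
Variables (alpha lambda : R).
Hypotheses (alpha_gt0 : 0 < alpha) (lambda_gt0 : 0 < lambda).
Local Notation s := (D / alpha).
Local Notation C := (CA A alpha).
Let c := C * lambda `^ alpha.
Let f := fun x : n.-tuple R =>
  lambda `^ D * expR (- (C * norm2 (dilate lambda x) `^ alpha)).

Let s0 : 0 < s. Proof. exact: divr_gt0. Qed.
Let C0 : 0 < C. Proof. exact: CA_gt0. Qed.
Let c0 : 0 < c. Proof. by rewrite mulr_gt0// powR_gt0. Qed.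
Let l0 : 0 < lambda `^ D. Proof. exact: powR_gt0. Qed.

Let fE x : f x = lambda `^ D * expR (- (c * norm2 x `^ alpha)).
Proof.
by rewrite /f norm2_dilate ?(ltW lambda_gt0)// powRM ?norm2_ge0 ?(ltW lambda_gt0)// mulrA.
Qed.

Let mf : measurable_fun setT f.
Proof.
rewrite (_ : f = fun x => lambda `^ D * expR (- (c * norm2 x `^ alpha))).
  by apply: measurable_funM => //; exact: measurable_radial_expR.
by apply/funext => x; exact: fE.
Qed.

Let f0 x : 0 <= f x. Proof. by rewrite mulr_ge0// ltW. Qed.

Let Cc : (C / c) `^ s = (lambda `^ D)^-1.
Proof.
rewrite /c invfM mulrA divff ?gt_eqF// mul1r -[RHS]powRN.
rewrite -[(lambda `^ alpha)^-1]powRN -powRrM.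
by congr (_ `^ _); field; rewrite gt_eqF.
Qed.

Lemma extremal_mass : (\int[nu]_(x in O) (f x)%:E = 1)%E.
Proof.
under eq_integral do rewrite fE EFinM.
rewrite ge0_integralZl//; last 2 first.
- apply/measurable_EFinP/measurable_funTS; exact: measurable_radial_expR.
- by rewrite lee_fin ltW.
by rewrite integral_orthant_expR// Cc -EFinM divff// gt_eqF.
Qed.

(** Radial integration evaluates c |x|^alpha + 1 against f as D / alpha + 1;
    the mass 1 of f is then subtracted. *)
Lemma extremal_moment :
  (\int[nu]_(x in O) (f x * norm2 x `^ alpha)%:E = (s / c)%:E)%E.
Proof.
have mr : measurable_fun setT (fun x => f x * norm2 x `^ alpha).
  apply: measurable_funM => //.
  by have := measurable_radial alpha 1; under eq_fun do rewrite mul1r.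
have r0 x : 0 <= f x * norm2 x `^ alpha by rewrite mulr_ge0// powR_ge0.
have : (c%:E * (\int[nu]_(x in O) (f x * norm2 x `^ alpha)%:E) + 1 = (s + 1)%:E)%E.
  rewrite -extremal_mass -ge0_integralZl//; last 3 first.
  - exact/measurable_EFinP/measurable_funTS.
  - by move=> x _; rewrite lee_fin.
  - by rewrite lee_fin ltW.
  rewrite -ge0_integralD//; last 4 first.
  - by move=> x _; rewrite mule_ge0// lee_fin// ltW.
  - by apply: measurable_funeM; exact/measurable_EFinP/measurable_funTS.
  - by move=> x _; rewrite lee_fin.
  - exact/measurable_EFinP/measurable_funTS.
  transitivity (\int[nu]_(x in O) ((lambda `^ D)%:E *
      ((c * norm2 x `^ alpha + 1) * expR (- (c * norm2 x `^ alpha)))%:E))%E.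
    apply: eq_integral => x _; rewrite -!EFinM -EFinD fE; congr EFin; ring.
  rewrite ge0_integralZl//; last 3 first.
  - apply/measurable_EFinP/measurable_funTS.
    apply: measurable_funM; last exact: measurable_radial_expR.
    by apply: measurable_funD => //; exact: measurable_radial.
  - by move=> x _; rewrite lee_fin mulr_ge0// addr_ge0// mulr_ge0 ?powR_ge0// ltW.
  - by rewrite lee_fin ltW.
  rewrite integral_orthant_id_expR// Cc -EFinM; congr EFin.
  by rewrite mulrC divfK// gt_eqF.
have : (0 <= \int[nu]_(x in O) (f x * norm2 x `^ alpha)%:E)%E.
  by apply: integral_ge0 => x _; rewrite lee_fin.
case: (\int[nu]_(x in O) _)%E => [r _|_|//].
  rewrite -EFinM -EFinD => -[/addIr <-].
  by rewrite mulrAC divff ?mul1r// gt_eqF.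
by rewrite gt0_muley ?lte_fin.
Qed.

Lemma extremal_Rmoment :
  (\int[nu]_(x in O) (f x * norm2 x `^ alpha))%R = s / c.
Proof. by rewrite /Rintegral extremal_moment. Qed.

(** The logarithm of f is D ln lambda - c |x|^alpha, so the entropy follows
    from the mass and the moment. *)
Lemma extremal_entropy :
  (- (\int[nu]_(x in O) (f x * ln (f x))%:E) =
   (s * ln (alpha * C * expR 1 / D * (s / c)))%:E)%E.
Proof.
have i1 : nu.-integrable O (fun x => (f x)%:E).
  apply/integrableP; split; first exact/measurable_EFinP/measurable_funTS.
  by under eq_integral do rewrite /= ger0_norm//; rewrite extremal_mass ltry.
have i2 : nu.-integrable O (fun x => (f x * norm2 x `^ alpha)%:E).
  apply/integrableP; split.
    apply/measurable_EFinP/measurable_funTS; apply: measurable_funM => //.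
    by have := measurable_radial alpha 1; under eq_fun do rewrite mul1r.
  under eq_integral do rewrite /= ger0_norm ?mulr_ge0 ?powR_ge0//.
  by rewrite extremal_moment ltry.
transitivity (- (\int[nu]_(x in O) ((D * ln lambda)%:E * (f x)%:E -
    c%:E * (f x * norm2 x `^ alpha)%:E)))%E.
  congr (- _)%E; apply: eq_integral => x _.
  rewrite [in ln _]fE lnM ?posrE ?expR_gt0// ln_powR expRK -!EFinM -EFinB.
  by congr EFin; ring.
rewrite (integralB mO (integrableZl mO _ i1) (integrableZl mO _ i2)).
rewrite !integralZl// extremal_mass extremal_moment mule1 -EFinM -EFinB -EFinN.
congr EFin.
rewrite (_ : _ * (s / c) = expR 1 * lambda `^ (- alpha)); last first.
  rewrite powRN /c; field; apply/and4P; split; apply: lt0r_neq0 => //.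
  exact: powR_gt0.
rewrite lnM ?posrE ?expR_gt0 ?powR_gt0// expRK ln_powR.
by field; rewrite !gt_eqF.
Qed.

Lemma extremal_L1alpha : L1alpha A alpha f.
Proof.
split; last first.
  under eq_integral do rewrite ger0_norm//.
  by rewrite extremal_moment ltry.
rewrite inE; apply/andP; split; rewrite inE//=.
rewrite /finite_norm Lnorm1.
under eq_integral do rewrite /= ger0_norm// fE EFinM.
rewrite ge0_integralZl//; last 2 first.
- apply/measurable_EFinP; exact: measurable_radial_expR.
- by rewrite lee_fin ltW.
by rewrite lte_mul_pinfty ?integral_expR_lty// lee_fin ltW.
Qed.

End extremal.

End entropy.

Theorem theorem1p5 (R : realType) (n : nat) (A : n.-tuple R)
    (n_ge1 : (1 <= n)%N) (A_ge0 : forall i : 'I_n, 0 <= tnth A i) :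
  (forall f : n.-tuple R -> R,
    f \in Lfun (measureA A) 2%:E ->
    (\int[measureA A]_(x in orthantA A) (`|f x| ^+ 2)%:E)%E = 1%E ->
    (\int[measureA A]_(x in orthantA A) (`|f x| ^+ 2 * norm2 x ^+ 2)%:E < +oo)%E ->
    (- (\int[measureA A]_(x in orthantA A)
          (`|f x| ^+ 2 * ln (`|f x| ^+ 2))%:E) <=
      (dimA A / 2 *
        ln (2 * PiA A * expR 1 / dimA A *
          (\int[measureA A]_(x in orthantA A)
            (`|f x| ^+ 2 * norm2 x ^+ 2))%R))%:E)%E)
  /\
  (forall alpha : R, 0 < alpha ->
    (forall f : n.-tuple R -> R,
      L1alpha A alpha f ->
      (\int[measureA A]_(x in orthantA A) `|f x|%:E)%E = 1%E ->
      (- (\int[measureA A]_(x in orthantA A) (`|f x| * ln `|f x|)%:E) <=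
        (dimA A / alpha *
          ln (alpha * CA A alpha * expR 1 / dimA A *
            (\int[measureA A]_(x in orthantA A)
              (`|f x| * norm2 x `^ alpha))%R))%:E)%E)
    /\
    (forall lambda : R, 0 < lambda ->
      let f := fun x : n.-tuple R =>
        lambda `^ dimA A *
          expR (- (CA A alpha * norm2 (dilate lambda x) `^ alpha)) in
      [/\ L1alpha A alpha f,
          (\int[measureA A]_(x in orthantA A) `|f x|%:E)%E = 1%E &
          (- (\int[measureA A]_(x in orthantA A) (`|f x| * ln `|f x|)%:E))%E =
            (dimA A / alpha *
              ln (alpha * CA A alpha * expR 1 / dimA A *
                (\int[measureA A]_(x in orthantA A)
                  (`|f x| * norm2 x `^ alpha))%R))%:E])).
Proof.
have Lfun_measurable p (f : n.-tuple R -> R) :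
    f \in Lfun (measureA A) p -> measurable_fun setT (fun x => `|f x|).
  rewrite inE => /andP[/set_mem mf _].
  exact: measurableT_comp (@normr_measurable _ _) mf.
split=> [f /Lfun_measurable mf f1 fM|alpha al0].
  have e x : norm2 x ^+ 2 = norm2 x `^ 2 :> R by rewrite powR_mulrn ?norm2_ge0.
  move: fM; under eq_integral do rewrite e; move=> fM.
  rewrite (_ : (\int[_]_(x in _) _)%R =
      (\int[measureA A]_(x in orthantA A) (`|f x| ^+ 2 * norm2 x `^ 2))%R); last first.
    by apply: eq_Rintegral => x _; rewrite e.
  rewrite -(CA2 n_ge1 A_ge0); apply: (entropy_le n_ge1 A_ge0 _ _ _ f1 fM) => //.
  exact: measurable_funX.
split=> [f [/Lfun_measurable mf fM] f1|lambda la0 f].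
  exact: (entropy_le n_ge1 A_ge0 al0 mf _ f1 fM).
have fE x : `|f x| = f x.
  by rewrite ger0_norm// mulr_ge0// ?powR_ge0 ?expR_ge0.
split.
- exact: extremal_L1alpha.
- by under eq_integral do rewrite fE; exact: extremal_mass.
- under eq_integral do rewrite fE.
  under eq_Rintegral do rewrite fE.
  by rewrite extremal_Rmoment// extremal_entropy.
Qed.
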